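(* Let $X$ and $Z$ be Hausdorff spaces and $Y$ be a topological vector space such that $Z\subset X\subset Y'_{w^*}$, with continuous injections, where $Y'_{w^*}$ is the dual space $Y'$ of $Y$ endowed with the weak-star topology, and assume $\mathfrak{B}_Z\subset\mathfrak{B}_X$. Let $I\subset\mathbb{R}$ be an interval and let $\mathcal{U}\subset\mathcal{X}_1$. Let $\rho$ be a $\mathcal{U}$-trajectory statistical solution over $I$ and let $\mathcal{V}$ be a Borel subset of $\mathcal{X}=\mathcal{C}_{\mathrm{loc}}(I,X)$ such that $\mathcal{V}\subset\mathcal{U}$ and $\rho(\mathcal{V})=1$. Suppose that there exist functions $\alpha:I\times X\to\mathbb{R}$ and $\beta:I\times Z\to\mathbb{R}$ which are $(\mathfrak{L}_I\otimes\mathfrak{B}_X,\mathfrak{B}_{\mathbb{R}})$-measurable and $(\mathfrak{L}_I\otimes\mathfrak{B}_Z,\mathfrak{B}_{\mathbb{R}})$-measurable, respectively, and satisfy the following conditions: (i) $(t,u)\mapsto\alpha(t,u(t))$ belongs to $L^1(J\times\mathcal{V},\lambda\times\rho)$, for every compact subset $J\subset I$; (ii) $(t,u)\mapsto\beta(t,u(t))$ belongs to $L^1(J\times\mathcal{V},\lambda\times\rho)$, for every compact subset $J\subset I$; (iii) for $\rho$-almost every $u\in\mathcal{V}$, $\frac{d}{dt}\alpha(t,u(t))+\beta(t,u(t))\le0$ in the sense of distributions on $I$, i.e. $$-\int_I\varphi'(s)\alpha(s,u(s))\,ds+\int_I\varphi(s)\beta(s,u(s))\,ds\le0$$ for all nonnegative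 test functions $\varphi\in\mathcal{C}^\infty_c(I)$. Then $$-\int_I\int_{\mathcal{V}}\varphi'(s)\alpha(s,u(s))\,d\rho(u)\,ds+\int_I\int_{\mathcal{V}}\varphi(s)\beta(s,u(s))\,d\rho(u)\,ds\le0$$ for all nonnegative test functions $\varphi\in\mathcal{C}^\infty_c(I)$. In terms of the family of projections $\{\rho_t\}_{t\in I}$, where $\rho_t=\Pi_t\rho$, this can be written as $$-\int_I\int_X\varphi'(s)\alpha(s,u)\,d\rho_s(u)\,ds+\int_I\int_X\varphi(s)\beta(s,u)\,d\rho_s(u)\,ds\le0.$$
   Context: $\mathfrak{B}_X$ denotes the Borel $\sigma$-algebra of a topological space; $\mathfrak{L}_I$ the Lebesgue $\sigma$-algebra of $I$; $\lambda$ the Lebesgue measure. Via the continuous injections, $Z$ is regarded as a subset of $X$ and $X$ as a subset of $Y'$; $\mathfrak{B}_Z\subset\mathfrak{B}_X$ means every Borel subset of $Z$ is a Borel subset of $X$. $\mathcal{C}^\infty_c(I)$ is the set of real-valued smooth functions compactly supported in the interior of $I$. A Borel measure $\mu$ is tight if $\mu(A)=\sup\{\mu(K):K\subset A\text{ compact}\}$ for all Borel $A$. $\mathcal{X}=\mathcal{C}_{\mathrm{loc}}(I,X)$ is the set of continuous functions $u:I\to X$ with the compact-open topology (subbase $\{u:u(J)\subset O\}$, $J\subset I$ compact subinterval, $O\subset X$ open). $\Pi_tu=u(t)$ and $\Pi_t\rho$ is the push-forward of $\rho$ by $\Pi_t$. A $\mathcal{U}$-trajectory statistical solution over $I$ is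 a tight Borel probability measure $\rho$ on $\mathcal{X}$ for which there is $\mathcal{V}\in\mathfrak{B}_{\mathcal{X}}$ with $\mathcal{V}\subset\mathcal{U}$ and $\rho(\mathcal{X}\setminus\mathcal{V})=0$. A function $w:I\to Y'$ has a property weak-star scalarwise if $t\mapsto\langle w(t),v\rangle_{Y',Y}$ has the property for every $v\in Y$. $\mathcal{Y}_1$ is the set of $u:I\to Y'$ that are weak-star scalarwise absolutely continuous (on compact subintervals of $I$) and for which there is a weak-star scalarwise locally integrable $w:I\to Y'$ with $\frac{d}{dt}\langle u(t),v\rangle_{Y',Y}=\langle w(t),v\rangle_{Y',Y}$ for a.e. $t\in I$, for every $v\in Y$. Further, $\mathcal{Z}=\{u\in\mathcal{X}:u(t)\in Z\text{ for a.e. }t\in I\}$ and $\mathcal{X}_1=\mathcal{Z}\cap\mathcal{Y}_1$. For $u\in\mathcal{X}_1$, $\beta(t,u(t))$ is defined for a.e. $t\in I$; for a.e. $t\in I$, $\rho_t$ gives full measure to $Z$, so the integrals of $\beta(t,\cdot)$ with respect to $\rho_t$ make sense. *)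

(* Defs.v *)
From HB Require Import structures.
From mathcomp Require Import all_boot all_order all_algebra.
From mathcomp Require Import all_classical all_reals all_analysis.

Set Implicit Arguments.
Unset Strict Implicit.
Unset Printing Implicit Defensive.

Import Order.TTheory GRing.Theory Num.Theory.
Import numFieldNormedType.Exports.

Local Open Scope classical_set_scope.
Local Open Scope ring_scope.

(* Functions of a time t in an interval I are represented by functions on R,
   their values outside I being irrelevant. Trajectories are the exception:
   they are functions on the subtype of I, so that two trajectories that agree
   on I are equal. *)

(* Measurable types are pointed in the library, hence ptopologicalType. *)
Notation borel T := (g_sigma_algebraType (@open T)).

(* R with the Lebesgue sigma-algebra; R itself carries the Borel one. *)
Notation lebesgueType R :=
  (caratheodory_type (measure_extension.mu_ext (@wlength R idfun))).

Notation leb R := (@completed_lebesgue_measure R).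

Section dual.
Context {R : realType} (Y : topologicalLmodType R).

Definition dual : set {ptws Y -> R^o} :=
  [set f | linear (f : Y -> R^o) /\ continuous (f : Y -> R^o)].

(* The weak-star topology is the topology of pointwise convergence on Y. *)
Definition weak_star := set_type dual.

HB.instance Definition _ := Topological.on weak_star.

Definition pairing (f : weak_star) (v : Y) : R := (set_val f : Y -> R^o) v.

End dual.

Section scalarwise.
Context {R : realType}.

Definition abs_continuous (a b : R) (f : R -> R) :=
  forall e : R, 0 < e -> exists2 d : R, 0 < d &
    forall (n : nat) (c c' : 'I_n -> R),
      (forall k, [/\ a <= c k, c k <= c' k & c' k <= b]) ->
      trivIset setT (fun k => `]c k, c' k[%classic) ->
      \sum_(k < n) (c' k - c k) < d ->
      \sum_(k < n) `|f (c' k) - f (c k)| < e.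

Definition loc_abs_continuous (I : set R) (f : R -> R) :=
  forall a b, a <= b -> `[a, b] `<=` I -> abs_continuous a b f.

Definition loc_integrable (I : set R) (f : R -> R) :=
  forall J : set R, compact J -> J `<=` I ->
    (leb R).-integrable J (fun t => (f t)%:E).

Context {Y : topologicalLmodType R}.

Definition scalarwise (P : (R -> R) -> Prop) (w : R -> weak_star Y) :=
  forall v, P (fun t => pairing (w t) v).

(* The derivative only sees values outside I at the endpoints of I, which form
   a null set. *)
Definition Y1 (I : set R) : set (R -> weak_star Y) :=
  [set u | scalarwise (loc_abs_continuous I) u /\
    exists2 w : R -> weak_star Y, scalarwise (loc_integrable I) w &
      forall v, {ae leb R, forall t : R, I t ->
        is_derive t 1 (fun s : R => pairing (u s) v) (pairing (w t) v)}].

End scalarwise.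

Section trajectories.
Context {R : realType} (I : set R) (X : ptopologicalType).

Local Notation ctsIX := (continuousType (set_type I) X).

HB.instance Definition _ :=
  @isPointed.Build ctsIX (@mkcts _ _ (cst point) (@cst_continuous _ _ point)).

(* On continuous functions on I, the compact subintervals and the compact
   subsets of I give the same compact-open topology. *)
Definition Cloc := initial_topology
  ((fun u => u) : ctsIX -> {compact-open, set_type I -> X}).

HB.instance Definition _ := Topological.on Cloc.
HB.instance Definition _ := Pointed.on Cloc.

(* Evaluation at time t, with a dummy value if t is not in I. *)
Definition Pi (t : R) (u : borel Cloc) : borel X := valL (u : ctsIX) t.

Lemma PiE (u : ctsIX) (t : set_type I) : Pi (set_val t) u = u t.
Proof. exact: (congr1 (fun f => f t) (valLK point (u : _ -> _))). Qed.

Lemma open_Pi (t : R) (O : set X) : open O -> open (Pi t @^-1` O : set Cloc).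
Proof.
move=> oO; have [It|nIt] := pselect (I t).
  pose s : set_type I := SigSub (mem_set It).
  exists [set g : {compact-open, set_type I -> X} | g @` [set s] `<=` O].
    by apply: compact_open_open => //; exact: compact_set1.
  apply/seteqP; split => u /=.
    by move/(_ (u s)) => uO; rewrite /= -[t]/(set_val s) PiE; apply: uO; exists s.
  by rewrite -[t]/(set_val s) PiE => uO _ [_ -> <-].
have -> : Pi t @^-1` O = cst (O point) :> (set Cloc).
  apply/funext => u; rewrite /preimage /Pi /valL_ /= oinv_set_val insubN//.
  by apply/negP => /set_mem.
have [|] := pselect (O point).
  by move/propT => ->; exact: openT.
by move/propF => ->; exact: open0.
Qed.

Lemma measurable_Pi (t : R) : measurable_fun [set: borel Cloc] (Pi t).
Proof.
apply: (@measurability _ _ (borel Cloc) (borel X) _ _ (@open X)) => // _ [A oA <-].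
by rewrite setTI; apply: sub_sigma_algebra; exact: open_Pi.
Qed.

HB.instance Definition _ (t : R) :=
  isMeasurableFun.Build _ _ (borel Cloc) (borel X) (Pi t) (measurable_Pi t).

End trajectories.

Section solutions.
Context {R : realType} (I : set R) {X Z : ptopologicalType}.
Context {Y : topologicalLmodType R}.
Context (i : X -> weak_star Y) (j : Z -> X).

Definition ae_in_Z : set (Cloc I X) :=
  [set u | {ae leb R, forall t : R, I t -> range j (Pi t u)}].

Definition X1 : set (Cloc I X) :=
  ae_in_Z `&` [set u | Y1 I (fun t => i (Pi t u))].

Definition tight (T : ptopologicalType) (mu : set (borel T) -> \bar R) :=
  forall A : set (borel T), measurable A ->
    mu A = ereal_sup [set mu K | K in [set K : set T | compact K /\ K `<=` A]].

Definition trajectory_statistical_solution (U : set (Cloc I X))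
    (rho : probability (borel (Cloc I X)) R) :=
  tight (T := Cloc I X) rho /\
  exists V : set (borel (Cloc I X)),
    [/\ measurable V, V `<=` U & rho (~` V) = 0%E].

End solutions.

(* The function f on Z, seen as a subset of X through j, extended by 0. *)
Definition ext0 {R : realType} {X Z : Type} (j : Z -> X) (f : Z -> R) (x : X) :
    R :=
  if pselect (exists z, j z = x) is left h then f (projT1 (cid h)) else 0.

Section distributions.
Context {R : realType} (I : set R).

Definition test_function (phi : R -> R) :=
  let supp := closure [set s | phi s != 0] in
  [/\ forall n s, derivable (derive1n n phi) s 1, compact supp & supp `<=` I°].

(* a' + b <= 0 in the sense of distributions on I *)
Definition distr_le0 (a b : R -> R) :=
  forall phi : R -> R, test_function phi -> (forall s, 0 <= phi s) ->
    - (\int[leb R]_(s in I) (derive1 phi s * a s))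
    + \int[leb R]_(s in I) (phi s * b s) <= 0.

End distributions.

(* Main.v *)
(* Write J for the support of phi. The functions phi'(s) alpha(s, u(s)) and
   phi(s) beta(s, u(s)) vanish for s outside J and are integrable on J x V, so
   Fubini turns the iterated integrals into integrals over u in V of the
   left-hand side of the distributional inequality along u, which is <= 0 for
   almost every u. For the second form, change variables in the inner
   integrals, at every s in I: alpha(s, .) is Borel on X and so is the
   extension of beta(s, .) by 0, because j maps Borel sets to Borel sets. *)
Require Import Defs.
From HB Require Import structures.
From mathcomp Require Import all_boot all_order all_algebra.
From mathcomp Require Import all_classical all_reals all_analysis.
From mathcomp Require Import measurable_realfun.

Set Implicit Arguments.
Unset Strict Implicit.
Unset Printing Implicit Defensive.

Import Order.TTheory GRing.Theory Num.Theory.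
Import numFieldNormedType.Exports.

Local Open Scope classical_set_scope.
Local Open Scope ring_scope.

(* The real-valued integral takes the junk value 0 where the extended one is
   infinite; if the latter is integrable, this changes it on a null set only. *)
Lemma integrable_EFin_fine d (T : measurableType d) (R : realType)
    (mu : {measure set T -> \bar R}) (D : set T) (F : T -> \bar R) :
    measurable D -> mu.-integrable D F ->
  mu.-integrable D (fun x => (fine (F x))%:E) /\
  (\int[mu]_(x in D) (fine (F x))%:E = \int[mu]_(x in D) F x)%E.
Proof.
move=> mD iF; have mF := measurable_int _ iF.
have mfF : measurable_fun D (fun x => (fine (F x) : R)%:E : \bar R).
  exact/measurable_EFinP/(measurableT_comp _ mF)/fine_measurable.
split.
  apply: le_integrable iF => // x _ /=.
  by case: (F x) => //=; rewrite normr0 leey.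
apply: ae_eq_integral => //.
have [N [mN N0 subN]] := integrable_ae mD iF.
exists N; split => // x nx; apply: subN => /= DF; apply: nx => Dx /=.
by rewrite fineK//; exact: DF.
Qed.

Lemma ae_Rintegral_le0 d (T : measurableType d) (R : realType)
    (mu : {measure set T -> \bar R}) (D : set T) (f : T -> R) :
    measurable D -> mu.-integrable D (EFin \o f) ->
    {ae mu, forall x, D x -> f x <= 0} ->
  \int[mu]_(x in D) f x <= 0.
Proof.
move=> mD fi [N [mN N0 subN]].
rewrite /Rintegral (negligible_integral mN)//.
have fiN : mu.-integrable (D `\` N) (EFin \o f).
  by apply: integrableS fi => //; exact: measurableD.
(* The bound 0 is written as the integral of the constant 0 over [D] minus [N], so that the
   integrands can be compared there. *)
rewrite -[leRHS](mul0r (fine (mu (D `\` N)))) -Rintegral_cst;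
  last exact: measurableD.
apply: le_Rintegral => //; [exact: measurableD|exact: integrable0|].
move=> x [Dx Nx]; apply: contrapT => fx; apply: Nx; apply: subN => /(_ Dx).
exact: fx.
Qed.

(** * Fubini's theorem for real-valued iterated integrals *)

Section real_fubini.
Context d1 d2 (T1 : measurableType d1) (T2 : measurableType d2) (R : realType).
Implicit Types (A : set T1) (B : set T2).

Variables (m1 : {sigma_finite_measure set T1 -> \bar R}).
Variables (m2 : {sigma_finite_measure set T2 -> \bar R}).

(** Counterpart of [integrable_fubini_F] for the other order: by Tonelli, the partial integrals of
    |f| form an integrable function, and it dominates those of [f]. *)
Lemma integrable_fubini_G (f : T1 * T2 -> \bar R) :
  (m1 \x m2)%E.-integrable setT f -> m2.-integrable setT (fubini_G m1 f).
Proof.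
move=> fi; have mf := measurable_int _ fi.
have maf : measurable_fun setT (abse \o f) by exact: measurableT_comp.
have mG := measurable_fun_fubini_tonelli_G (m1 := m1) _ maf (fun=> abse_ge0 _).
have absE y : `|fubini_G m1 (abse \o f) y|%E = fubini_G m1 (abse \o f) y.
  by rewrite gee0_abs//; apply: integral_ge0 => x _; exact: abse_ge0.
apply: (@le_integrable _ _ _ _ _ measurableT _ (fubini_G m1 (abse \o f))).
- exact: measurable_fubini_G fi.
- move=> y _; rewrite absE; apply: le_abse_integral => //.
  by apply: (measurableT_comp mf); exact: pair2_measurable.
- apply/integrableP; split => //.
  under eq_integral do rewrite absE.
  exact: (integrable21ltyP m1 m2 mf).1.
Qed.

(** Fubini applies on the whole product to [g], the extension of [f] by 0 outside [A] times [B],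
    whose partial integrals are the extensions by 0 of those of [f]. The integrability over [B]
    serves later to subtract two such integrals. *)
Lemma Rintegral_Fubini A B (f : T1 * T2 -> R) :
    measurable A -> measurable B ->
    (m1 \x m2)%E.-integrable (A `*` B) (EFin \o f) ->
  m2.-integrable B (fun y => (\int[m1]_(x in A) f (x, y))%:E) /\
  \int[m1]_(x in A) \int[m2]_(y in B) f (x, y) =
  \int[m2]_(y in B) \int[m1]_(x in A) f (x, y).
Proof.
move=> mA mB fi.
have mAB : measurable (A `*` B) by exact: measurableX.
have gi := (integrable_mkcond _ mAB).1 fi.
set g := (_ \_ _) in gi.
have GE y : fubini_G m1 g y =
    ((fun y => \int[m1]_(x in A) (f (x, y))%:E)%E \_ B) y.
  rewrite patchE /fubini_G; case: ifPn => yB.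
    rewrite [RHS]integral_mkcond; apply: eq_integral => x _.
    by rewrite /g !patchE in_setX yB andbT.
  by apply: integral0_eq => x _; rewrite /g patchE in_setX (negbTE yB) andbF.
have FE x : fubini_F m2 g x =
    ((fun x => \int[m2]_(y in B) (f (x, y))%:E)%E \_ A) x.
  rewrite patchE /fubini_F; case: ifPn => xA.
    rewrite [RHS]integral_mkcond; apply: eq_integral => y _.
    by rewrite /g !patchE in_setX xA.
  by apply: integral0_eq => y _; rewrite /g patchE in_setX (negbTE xA).
have iF := integrable_fubini_F gi.
have iG := integrable_fubini_G gi.
have eFG := Fubini gi.
rewrite -/(fubini_F m2 g) in eFG.
have {}FE : fubini_F m2 g = _ := funext FE.
have {}GE : fubini_G m1 g = _ := funext GE.
rewrite FE in iF; rewrite GE in iG.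
(* Passing from extended to real inner integrals changes neither outer integral and keeps
   integrability. *)
move/(integrable_mkcond _ mA) : iF => /(integrable_EFin_fine mA)[_ eF].
move/(integrable_mkcond _ mB) : iG => /(integrable_EFin_fine mB)[iG eG].
split => //; congr fine; rewrite eF eG.
rewrite [LHS]integral_mkcond -FE [RHS]integral_mkcond -GE.
exact: eFG.
Qed.

Lemma iterated_Rintegral_le0 A B (f g : T1 * T2 -> R) :
    measurable A -> measurable B ->
    (m1 \x m2)%E.-integrable (A `*` B) (EFin \o f) ->
    (m1 \x m2)%E.-integrable (A `*` B) (EFin \o g) ->
    {ae m2, forall y, B y ->
      - (\int[m1]_(x in A) f (x, y)) + \int[m1]_(x in A) g (x, y) <= 0} ->
  - (\int[m1]_(x in A) \int[m2]_(y in B) f (x, y))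
  + \int[m1]_(x in A) \int[m2]_(y in B) g (x, y) <= 0.
Proof.
move=> mA mB fi gi fg.
have [iF ->] := Rintegral_Fubini mA mB fi.
have [iG ->] := Rintegral_Fubini mA mB gi.
(* The two integrals over [B] merge, both integrands being integrable; up to the order of its terms,
   the new integrand is the quantity bounded in [fg]. *)
rewrite addrC -RintegralB//; apply: ae_Rintegral_le0 => //.
  by apply: eq_integrable (integrableB mB iG iF).
by apply: filterS fg => y /[apply]; rewrite addrC.
Qed.

End real_fubini.

(** * Change of variables and extension by 0 *)

(** Positive and negative parts are transported separately, so the identity survives when [f] is not
    integrable. It is used at every time s in [I], whereas [h1] and [h2] make the sections
    integrable only for almost every s. *)
Lemma Rintegral_distribution_full_measure d d' (T : measurableType d)
    (T' : measurableType d') (R : realType) (P : probability T R)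
    (X : {RV P >-> T'}) (V : set T) (f : T' -> R) :
    measurable V -> P V = 1%E -> measurable_fun [set: T'] f ->
  \int[distribution P X]_x f x = \int[P]_(u in V) f (X u).
Proof.
move=> mV PV mf; congr fine.
have PV0 : P (~` V) = 0%E by rewrite probability_setC// PV subee.
have ge0E (h : T' -> \bar R) : measurable_fun [set: T'] h ->
    (forall x, (0 <= h x)%E) ->
    (\int[distribution P X]_x h x = \int[P]_(u in V) h (X u))%E.
  move=> mh h0; rewrite ge0_integral_distribution//.
  have mhX : measurable_fun [set: T] (h \o X) by exact: measurableT_comp.
  rewrite (ge0_negligible_integral (measurableC mV))//;
    last by move=> x _; exact: h0.
  by rewrite setTD setCK.
have mEf : measurable_fun [set: T'] (EFin \o f) by exact/measurable_EFinP.
rewrite integralE [RHS]integralE; congr (_ - _)%E.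
  rewrite (ge0E (EFin \o f)^\+%E)//; last exact: measurable_funepos.
  by apply: eq_integral => u _; rewrite !funeposE.
rewrite (ge0E (EFin \o f)^\-%E)//; last exact: measurable_funeneg.
by apply: eq_integral => u _; rewrite !funenegE.
Qed.

(** The preimage of [B] is the image under [j] of a Borel set of [Z], together with the complement
    of the range of [j] when [B] contains 0. *)
Lemma measurable_ext0 (R : realType) (X Z : ptopologicalType) (j : Z -> X)
    (f : Z -> R) : injective j ->
    (forall B : set (borel Z),
      measurable B -> measurable (j @` B : set (borel X))) ->
    measurable_fun [set: borel Z] f ->
  measurable_fun [set: borel X] (ext0 j f).
Proof.
move=> j_inj hj mf _ B mB; rewrite setTI.
have fE z : ext0 j f (j z) = f z.
  rewrite /ext0; case: pselect => [h|]; last by case; exists z.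
  by congr f; apply: j_inj; case: (cid h).
have f0 x : ~ range j x -> ext0 j f x = 0.
  rewrite /ext0; by case: pselect => // -[z jzx] []; exists z.
have mfB : measurable (f @^-1` B : set (borel Z)).
  by rewrite -[X in measurable X]setTI; exact: mf.
have -> : ext0 j f @^-1` B =
    (j @` (f @^-1` B) `|` (~` range j `&` [set _ | B 0]) : set (borel X)).
  apply/seteqP; split => x /=.
    have [[z _ <-]|nx] := pselect (range j x).
      by rewrite fE => Bz; left; exists z.
    by rewrite f0// => B0; right.
  by case => [[z Bz <-]|[nx B0]]; rewrite ?fE ?f0.
apply: measurableU; first exact: hj.
apply: measurableI; last first.
  have [B0|B0] := pselect (B 0).
    by rewrite (_ : [set _ | _] = setT)//; apply/seteqP; split.
  by rewrite (_ : [set _ | _] = set0)//; apply/seteqP; split.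
by apply: measurableC; exact: hj.
Qed.

(** * Lebesgue measurability in time and supports of test functions *)

Lemma measurable_lebesgueType (R : realType) (A : set R) :
  measurable A -> measurable (A : set (lebesgueType R)).
Proof. by move=> mA; exact: sub_caratheodory. Qed.

(** Measurability on [I] times [T2] controls preimages cut down to that set; as [s] lies in [I],
    their sections at [s] are full preimages. *)
Lemma measurable_xsection_fun d1 d2 d3 (T1 : measurableType d1)
    (T2 : measurableType d2) (T3 : measurableType d3) (I : set T1)
    (f : T1 * T2 -> T3) (s : T1) : measurable I -> I s ->
  measurable_fun (I `*` [set: T2]) f ->
  measurable_fun [set: T2] (fun x => f (s, x)).
Proof.
move=> mI Is mf _ B mB; rewrite setTI.
have := measurable_xsection s (mf (measurableX mI measurableT) B mB).
congr measurable; apply/seteqP; split => x.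
  by rewrite /xsection/= inE/= => -[].
by rewrite /xsection/= inE/=.
Qed.

Lemma Rintegral_supported d (T : measurableType d) (R : realType)
    (mu : {measure set T -> \bar R}) (I J : set T) (f : T -> R) :
    J `<=` I -> (forall x, ~ J x -> f x = 0) ->
  \int[mu]_(x in I) f x = \int[mu]_(x in J) f x.
Proof.
move=> JI f0; rewrite Rintegral_mkcond [RHS]Rintegral_mkcond.
apply: eq_Rintegral => x _; rewrite !patchE.
have [/set_mem/JI Ix|/negP nJx] := boolP (x \in J); first by rewrite mem_set.
by rewrite f0 ?if_same// => Jx; apply: nJx; rewrite inE.
Qed.

(** The complement of the support is open, so [phi] is 0 on a neighbourhood of [s]. *)
Lemma derive1_supp (R : realType) (phi : R -> R) (s : R) :
  ~ closure [set x | phi x != 0] s -> derive1 phi s = 0.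
Proof.
move=> ns; rewrite derive1E.
rewrite (@near_eq_derive _ _ _ _ (cst 0)) ?derive_cst//.
have : open (~` closure [set x | phi x != 0]).
  by apply: closed_openC; exact: closed_closure.
move/(_ s ns); apply: filterS => x nx /=; apply/eqP; apply: contrapT => /negP h.
by apply: nx; exact: subset_closure.
Qed.

(** The factor [h] is bounded on the compact [J]; it will be [phi] or its derivative. *)
Lemma integrable_continuousMl (R : realType) d (T : measurableType d)
    (mu : probability T R) (J : set R) (V : set T) (h : R -> R)
    (f : lebesgueType R * T -> R) :
    compact J -> measurable V -> continuous h ->
    (leb R \x mu)%E.-integrable (J `*` V) (EFin \o f) ->
  (leb R \x mu)%E.-integrable (J `*` V)
    (EFin \o (fun tu => h tu.1 * f tu)).
Proof.
move=> cJ mV ch fi.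
have mJ : measurable (J : set (lebesgueType R)).
  by apply: measurable_lebesgueType; exact: compact_measurable.
have mJV : measurable (J `*` V : set (lebesgueType R * T)).
  exact: measurableX.
have hK : compact (h @` J).
  by apply: continuous_compact => //; exact: continuous_subspaceT.
apply: (@integrableMr _ _ _ _ _ mJV (h \o fst) (EFin \o f)) => //.
  apply: (@measurableT_comp _ _ _ _ _ _ _ _
    (fst : lebesgueType R * T -> lebesgueType R)).
    (* By continuity, [h] pulls Borel sets back to Borel, hence Lebesgue, sets. *)
    move=> _ B mB; rewrite setTI; apply: measurable_lebesgueType.
    by rewrite -[X in measurable X]setTI; apply: continuous_measurable_fun.
  exact: measurable_funS measurable_fst.
have [M [Mr hM]] := compact_bounded hK.
exists M; split => // x /hM Mx [t u] [/= Jt _]; apply: Mx; exact: imageP.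
Qed.

(** * Averaging the inequality over trajectories *)

Theorem proposition3p1 (R : realType)
  (X Z : ptopologicalType) (Y : topologicalLmodType R)
  (hX : hausdorff_space X) (hZ : hausdorff_space Z)
  (i : X -> weak_star Y) (i_inj : injective i) (i_cts : continuous i)
  (j : Z -> X) (j_inj : injective j) (j_cts : continuous j)
  (hBorel : forall B : set (borel Z),
    measurable B -> measurable (j @` B : set (borel X)))
  (I : set R) (hI : is_interval I)
  (U : set (Cloc I X)) (hU : U `<=` X1 i j)
  (rho : probability (borel (Cloc I X)) R)
  (hrho : trajectory_statistical_solution U rho)
  (V : set (borel (Cloc I X))) (mV : measurable V) (hVU : V `<=` U)
  (hV : rho V = 1%E)
  (alpha : R -> X -> R) (beta : R -> Z -> R)
  (malpha : @measurable_fun _ _ (lebesgueType R * borel X)%type R (I `*` setT)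
    (fun tx => alpha tx.1 tx.2))
  (mbeta : @measurable_fun _ _ (lebesgueType R * borel Z)%type R (I `*` setT)
    (fun tz => beta tz.1 tz.2))
  (h1 : forall J : set R, compact J -> J `<=` I ->
    (leb R \x rho)%E.-integrable (J `*` V)
      (fun tu => (alpha tu.1 (Pi tu.1 tu.2))%:E))
  (h2 : forall J : set R, compact J -> J `<=` I ->
    (leb R \x rho)%E.-integrable (J `*` V)
      (fun tu => (ext0 j (beta tu.1) (Pi tu.1 tu.2))%:E))
  (h3 : {ae rho, forall u, V u ->
    distr_le0 I (fun s => alpha s (Pi s u))
                (fun s => ext0 j (beta s) (Pi s u))}) :
  forall phi : R -> R, test_function I phi -> (forall s, 0 <= phi s) ->
    - (\int[leb R]_(s in I) \int[rho]_(u in V)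
        (derive1 phi s * alpha s (Pi s u)))
    + \int[leb R]_(s in I) \int[rho]_(u in V)
        (phi s * ext0 j (beta s) (Pi s u)) <= 0
    /\
    - (\int[leb R]_(s in I) \int[distribution rho (Pi s)]_x
        (derive1 phi s * alpha s x))
    + \int[leb R]_(s in I) \int[distribution rho (Pi s)]_x
        (phi s * ext0 j (beta s) x) <= 0.
Proof.
move=> phi [phi_smooth supp_cpt suppI] phi_ge0.
set J := closure _ in supp_cpt suppI.
have JI : J `<=` I by exact: subset_trans suppI (@interior_subset _ _).
have mJ : measurable (J : set (lebesgueType R)).
  by apply: measurable_lebesgueType; exact: compact_measurable.
have mI : measurable (I : set (lebesgueType R)).
  by apply: measurable_lebesgueType; exact: is_interval_measurable.
have phi_cts : continuous phi.
  move=> s; apply: differentiable_continuous; apply/derivable1_diffP.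
  exact: (phi_smooth 0%N s).
have dphi_cts : continuous (derive1 phi).
  move=> s; apply: differentiable_continuous; apply/derivable1_diffP.
  exact: (phi_smooth 1%N s).
have dphi0 s : ~ J s -> derive1 phi s = 0 by exact: derive1_supp.
have phi0 s : ~ J s -> phi s = 0.
  move=> nJs; apply: contrapT => /eqP ps; apply: nJs.
  exact: subset_closure.
have ia := integrable_continuousMl supp_cpt mV dphi_cts (h1 J supp_cpt JI).
have ib := integrable_continuousMl supp_cpt mV phi_cts (h2 J supp_cpt JI).
(* [h1] and [h2] give integrability over compact sets only; the factors [phi] and [derive1 phi]
   allow [I] to be exchanged for [J]. *)
have int_supp (f : R -> R) : (forall s, ~ J s -> f s = 0) ->
    \int[leb R]_(s in I) f s = \int[leb R]_(s in J) f s.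
  exact: (@Rintegral_supported _ (lebesgueType R)).
have le0 : - (\int[leb R]_(s in I) \int[rho]_(u in V)
        (derive1 phi s * alpha s (Pi s u)))
    + \int[leb R]_(s in I) \int[rho]_(u in V)
        (phi s * ext0 j (beta s) (Pi s u)) <= 0.
  rewrite int_supp; last first.
    by move=> s /dphi0 ->; rewrite /Rintegral integral0_eq// => u _;
      rewrite mul0r.
  rewrite int_supp; last first.
    by move=> s /phi0 ->; rewrite /Rintegral integral0_eq// => u _;
      rewrite mul0r.
  apply: (iterated_Rintegral_le0 mJ mV ia ib).
  (* The integrals in [distr_le0] run over [I]; along each trajectory they too are cut down to
     [J]. *)
  apply: filterS h3 => u /[apply] /(_ phi) /=.
  rewrite int_supp; last by move=> s /dphi0 ->; rewrite mul0r.
  rewrite int_supp; last by move=> s /phi0 ->; rewrite mul0r.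
  exact.
split=> //.
have mas s : I s -> measurable_fun [set: borel X] (alpha s).
  by move=> Is; exact: (measurable_xsection_fun mI Is malpha).
have mbs s : I s -> measurable_fun [set: borel X] (ext0 j (beta s)).
  move=> Is; apply: measurable_ext0 => //.
  exact: (measurable_xsection_fun mI Is mbeta).
(* Under the outer integral s is known to lie in [I], which [mas] and [mbs] require. After both
   changes of variables the goal is [le0]. *)
under eq_Rintegral => s /set_mem Is.
  rewrite (Rintegral_distribution_full_measure _ mV hV); last first.
    by apply: measurable_funM => //; exact: mas.
  over.
under [X in _ + X]eq_Rintegral => s /set_mem Is.
  rewrite (Rintegral_distribution_full_measure _ mV hV); last first.
    by apply: measurable_funM => //; exact: mbs.
  over.
exact: le0.
Qed.
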